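(* Let $\epsilon_X,\epsilon_Y\in(-1,1)$, $0<h<1/2$, and put $\kappa=\frac{1-h}{h}$. The global maps along the heteroclinic orbits of the network are given as follows. In $(P,P)$ coordinates: $$\Psi_{(P,P)\to(P,S)}(z_1,z_2,z_3,h)=\Big(\kappa^{\frac{1-\epsilon_X}{1-\epsilon_Y}}z_1,\ \kappa^{\frac{2}{1-\epsilon_Y}}z_2,\ \kappa^{-\frac{3+\epsilon_Y}{1-\epsilon_Y}}z_3,\ 1-h\Big),$$ $$\Psi_{(P,P)\to(S,P)}(z_1,h,z_3,z_4)=\Big(\kappa^{-\frac{3+\epsilon_X}{1-\epsilon_X}}z_1,\ 1-h,\ \kappa^{\frac{1-\epsilon_Y}{1-\epsilon_X}}z_3,\ \kappa^{\frac{2}{1-\epsilon_X}}z_4\Big).$$ In $(P,S)$ coordinates: $$\Psi_{(P,S)\to(R,S)}(h,z_2,z_3,z_4)=\Big(1-h,\ \kappa^{\epsilon_X}z_2,\ \kappa^{-\frac{1-\epsilon_Y}{2}}z_3,\ \kappa^{\frac{1+\epsilon_Y}{2}}z_4\Big),$$ $$\Psi_{(P,S)\to(S,S)}(z_1,h,z_3,z_4)=\Big(\kappa^{-\frac{-3+\epsilon_X}{1+\epsilon_X}}z_1,\ 1-h,\ \kappa^{-\frac{1+\epsilon_Y}{1+\epsilon_X}}z_3,\ \kappa^{-\frac{2}{1+\epsilon_X}}z_4\Big).$$ In $(S,P)$ coordinates: $$\Psi_{(S,P)\to(S,S)}(z_1,z_2,z_3,h)=\Big(\kappa^{-\frac{1+\epsilon_X}{1+\epsilon_Y}}z_1,\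 \kappa^{-\frac{2}{1+\epsilon_Y}}z_2,\ \kappa^{-1+\frac{4}{1+\epsilon_Y}}z_3,\ 1-h\Big),$$ $$\Psi_{(S,P)\to(S,R)}(z_1,z_2,h,z_4)=\Big(\kappa^{-\frac{1-\epsilon_X}{2}}z_1,\ \kappa^{\frac{1+\epsilon_X}{2}}z_2,\ 1-h,\ \kappa^{\epsilon_Y}z_4\Big).$$
   Context: System. For $\epsilon\in(-1,1)$ let $M(\epsilon)$ be the $3\times 3$ matrix with rows $(\tfrac23\epsilon,\,1-\tfrac13\epsilon,\,-1-\tfrac13\epsilon)$, $(-1-\tfrac13\epsilon,\,\tfrac23\epsilon,\,1-\tfrac13\epsilon)$, $(1-\tfrac13\epsilon,\,-1-\tfrac13\epsilon,\,\tfrac23\epsilon)$. Put $A=M(\epsilon_X)$, $B=M(\epsilon_Y)$. The system is $\dot x_i=x_i[(Ay)_i-x^TAy]$, $\dot y_j=y_j[(Bx)_j-y^TBx]$, with $x,y$ in the standard 2-simplex, in coordinates $(x_1,x_2,y_1,y_2)$ with $x_3=1-x_1-x_2$, $y_3=1-y_1-y_2$. Put $R=(1,0)$, $S=(0,1)$, $P=(0,0)$; each $(V,U)$ with $V,U\in\{R,S,P\}$ is an equilibrium. The open straight segments $(P,P)\to(P,S)$, $(P,P)\to(S,P)$, $(P,S)\to(R,S)$, $(P,S)\to(S,S)$, $(S,P)\to(S,S)$, $(S,P)\to(S,R)$ are heteroclinic orbits in the indicated directions. Local coordinates $(z_1,z_2,z_3,z_4)$: at $(P,P)$, $z=(x_1,x_2,y_1,y_2)$;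 at $(P,S)$, $z=(x_1,x_2,y_1,y_1+y_2-1)$; at $(S,P)$, $z=(x_1,x_1+x_2-1,y_1,y_2)$. In each case the base equilibrium is the origin, the linearization there is diagonal, and the other endpoint of each of its two orbits listed above is a standard basis vector $e_k$. Global map. For a heteroclinic orbit $v\to w$ with $w=e_k$ in the $v$-coordinates, write $\tilde z$ for the three coordinates other than $z_k$, and $\dot z_k=\zeta(z_k,\tilde z)$, $\dot{\tilde z}=g(z_k,\tilde z)$ for the system. The global map $\Psi_{v\to w}$, from $\{z_k=h\}$ to $\{z_k=1-h\}$, is the transition map of the system linearized along the orbit: it sends $\tilde z(h)$ to $\tilde z(1-h)$, where $\tilde z(\cdot)$ solves $\frac{d\tilde z}{dz_k}=\frac{1}{\zeta(z_k,0)}\,\partial_{\tilde z}g(z_k,0)\,\tilde z$. *)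

(* Defs.v *)
From mathcomp Require Import all_boot all_order all_algebra.
From mathcomp Require Import all_classical all_reals all_analysis.
From mathcomp Require Import ring.

Set Implicit Arguments.
Unset Strict Implicit.
Unset Printing Implicit Defensive.

Import Order.TTheory GRing.Theory Num.Theory.
Import numFieldNormedType.Exports.

Local Open Scope classical_set_scope.
Local Open Scope ring_scope.

Section System.
Variable R : realType.
Implicit Types (e eX eY h t a b c d : R) (p z : 'rV[R]_4).

Definition row4 a b c d : 'rV[R]_4 := \row_i [:: a; b; c; d]`_i.

Definition payoff e : 'M[R]_3 :=
  \matrix_(i, j) nth 0 (nth [::]
    [:: [:: 2 / 3 * e; 1 - 1 / 3 * e; - 1 - 1 / 3 * e];
        [:: - 1 - 1 / 3 * e; 2 / 3 * e; 1 - 1 / 3 * e];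
        [:: 1 - 1 / 3 * e; - 1 - 1 / 3 * e; 2 / 3 * e]] i) j.

Definition mixed a b : 'cV[R]_3 := \col_i [:: a; b; 1 - a - b]`_i.

Definition replicator (M : 'M[R]_3) (u v : 'cV[R]_3) (i : 'I_3) : R :=
  u i 0 * ((M *m v) i 0 - (u^T *m M *m v) 0 0).

(* The polynomial vector field on all of R^4, in coordinates
   (x_1, x_2, y_1, y_2); the entries of p, x and y are indexed from 0. *)
Definition field eX eY p : 'rV[R]_4 :=
  let x := mixed (p 0 (inord 0)) (p 0 (inord 1)) in
  let y := mixed (p 0 (inord 2)) (p 0 (inord 3)) in
  row4 (replicator (payoff eX) x y (inord 0))
       (replicator (payoff eX) x y (inord 1))
       (replicator (payoff eY) y x (inord 0))
       (replicator (payoff eY) y x (inord 1)).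

End System.

Inductive strategy := Rock | Scissors | Paper.

Definition vertex (R : realType) (w : strategy * strategy) : 'rV[R]_4 :=
  let corner s : R * R := match s with
    | Rock => (1, 0) | Scissors => (0, 1) | Paper => (0, 0) end in
  row4 (corner w.1).1 (corner w.1).2 (corner w.2).1 (corner w.2).2.

(* The equilibria from which the six connections leave, each of which carries
   its own local coordinates. *)
Inductive source := PP | PS | SP.

Definition base (v : source) : strategy * strategy :=
  match v with
  | PP => (Paper, Paper) | PS => (Paper, Scissors) | SP => (Scissors, Paper)
  end.

Section Connection.
Variable R : realType.
Implicit Types (eX eY h t : R) (p z : 'rV[R]_4) (v : source).

Definition chart v p : 'rV[R]_4 :=
  let x1 := p 0 (inord 0) in let x2 := p 0 (inord 1) in
  let y1 := p 0 (inord 2) in let y2 := p 0 (inord 3) in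
  match v with
  | PP => row4 x1 x2 y1 y2
  | PS => row4 x1 x2 y1 (y1 + y2 - 1)
  | SP => row4 x1 (x1 + x2 - 1) y1 y2
  end.

Definition unchart v z : 'rV[R]_4 :=
  let z1 := z 0 (inord 0) in let z2 := z 0 (inord 1) in
  let z3 := z 0 (inord 2) in let z4 := z 0 (inord 3) in
  match v with
  | PP => row4 z1 z2 z3 z4
  | PS => row4 z1 z2 z3 (z4 - z3 + 1)
  | SP => row4 z1 (z2 - z1 + 1) z3 z4
  end.

Lemma row4P (z z' : 'rV[R]_4) :
  z 0 (inord 0) = z' 0 (inord 0) -> z 0 (inord 1) = z' 0 (inord 1) ->
  z 0 (inord 2) = z' 0 (inord 2) -> z 0 (inord 3) = z' 0 (inord 3) -> z = z'.
Proof.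
move=> e0 e1 e2 e3; apply/rowP => -[[|[|[|[|//]]]] hi].
- by move: e0; congr (_ = _); congr (_ _ _); apply/val_inj; rewrite /= inordK.
- by move: e1; congr (_ = _); congr (_ _ _); apply/val_inj; rewrite /= inordK.
- by move: e2; congr (_ = _); congr (_ _ _); apply/val_inj; rewrite /= inordK.
- by move: e3; congr (_ = _); congr (_ _ _); apply/val_inj; rewrite /= inordK.
Qed.

Lemma chartK v : cancel (chart v) (unchart v).
Proof.
by move=> p; case: v; apply: row4P; rewrite !mxE !inordK //= ?mxE ?inordK //=; ring.
Qed.

Lemma unchartK v : cancel (unchart v) (chart v).
Proof.
by move=> p; case: v; apply: row4P; rewrite !mxE !inordK //= ?mxE ?inordK //=; ring.
Qed.

Lemma chart_base v : chart v (vertex R (base v)) = 0.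
Proof.
by case: v; apply: row4P; rewrite !mxE !inordK //= ?mxE ?inordK //=; ring.
Qed.

Definition local_field eX eY v z : 'rV[R]_4 :=
  'd (chart v) (unchart v z) (field eX eY (unchart v z)).

(* The point with k-th coordinate t and remaining coordinates w. *)
Definition insert (k : 'I_4) t (w : 'rV[R]_3) : 'rV[R]_4 :=
  \row_i if unlift k i is Some j then w 0 j else t.

Definition zeta eX eY v (k : 'I_4) t (w : 'rV[R]_3) : R :=
  local_field eX eY v (insert k t w) 0 k.

Definition transverse eX eY v (k : 'I_4) t (w : 'rV[R]_3) : 'rV[R]_3 :=
  col' k (local_field eX eY v (insert k t w)).

(* Vectors are rows, so the Jacobian acts on the right. The equation is imposed
   on the whole open orbit 0 < z_k < 1, on which zeta (z_k, 0) does not vanish. *)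
Definition linearized_solution eX eY v k (zt : R -> 'rV[R]_3) : Prop :=
  forall t, 0 < t < 1 ->
    is_derive t 1 zt
      ((zeta eX eY v k t 0)^-1 *: (zt t *m 'J (transverse eX eY v k t) 0)).

(* Graph of the global map along v -> w, from {z_k = h} to {z_k = 1 - h}. That
   this relation is a function is not built in: it amounts to existence and
   uniqueness for the linearized equation. *)
Definition global_map eX eY h v (w : strategy * strategy) z z' : Prop :=
  exists k : 'I_4,
    [/\ chart v (vertex R w) = delta_mx 0 k, z 0 k = h, z' 0 k = 1 - h &
        exists zt : R -> 'rV[R]_3,
          [/\ linearized_solution eX eY v k zt,
              zt h = col' k z & zt (1 - h) = col' k z']].

End Connection.

(* Main.v *)
Require Import Defs.
From mathcomp Require Import all_boot all_order all_algebra.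
From mathcomp Require Import all_classical all_reals all_analysis.
From mathcomp Require Import ring lra.

Set Implicit Arguments.
Unset Strict Implicit.
Unset Printing Implicit Defensive.

Import Order.TTheory GRing.Theory Num.Theory.
Import numFieldNormedType.Exports.

Local Open Scope classical_set_scope.
Local Open Scope ring_scope.

(** In the local coordinates of each of the three sources, every coordinate is,
    up to sign, a barycentric coordinate of one of the two players. The
    replicator equation multiplies a barycentric coordinate by its growth rate,
    so the field reads [dz_i/ds = z_i * rate_i z] ([local_field_rate]): all four
    coordinate hyperplanes are invariant. Two consequences carry the proof.

    Along the orbit on the k-th axis the transverse Jacobian is diagonal, with
    the rates as entries ([jacobian_transverse]), so that the linearized equation
    decouples into three scalar ones.

    On that axis only one player moves, and the rates are affine in its mixed
    strategy. Hence they interpolate linearly between the eigenvalues [a] at the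
    source and [b] at the target ([rate_edge]). As the target is an equilibrium,
    [b_k = 0], and the orbit itself obeys [dz_k/ds = a_k z_k (1 - z_k)]. Dividing,
    each transverse coordinate satisfies
    [du/dt = (p / t + q / (1 - t)) u] with [p = a_i / a_k] and [q = b_i / a_k],
    whose solutions are the multiples of [t ^ p (1 - t) ^ (- q)]. From [t = h] to
    [t = 1 - h] they grow by the factor [kappa ^ (p + q)] ([singular_ode_ratio]).

    The global map therefore multiplies the i-th coordinate by
    [kappa ^ ((a_i + b_i) / a_k)] ([global_mapP]), and the six formulas follow
    from the eigenvalues at the two ends of each orbit. *)

(** * Rows of functions: continuity, derivatives, differentials *)

Lemma continuous_row (T : topologicalType) (R : realType) n (f : T -> 'rV[R]_n)
    x :
  (forall j, {for x, continuous (fun t => f t 0 j)}) -> {for x, continuous f}.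
Proof.
move=> cf; apply/cvgrPdist_le => e e0; near=> t.
rewrite [leLHS]/Num.Def.normr/= mx_normrE (bigmax_le _ (ltW e0))//= => -[i j] _.
rewrite !mxE/= ord1; move: j; near: t; apply: filter_forall => j.
by move/cvgrPdist_le: (cf j); apply.
Unshelve. all: by end_near. Qed.

Lemma continuous_sum (T : topologicalType) (R : realType) n
    (F : 'I_n -> T -> R) x :
  (forall i, {for x, continuous (F i)}) ->
  {for x, continuous (fun t => \sum_i F i t)}.
Proof.
move=> cF; have := @cvg_big R 'I_n +%R 0 xpredT (@add_continuous R) T (nbhs x)
  (index_enum 'I_n) F (F ^~ x) _ (fun i _ => cF i).
by apply.
Qed.

Lemma continuous_mulmxr (R : realType) m n (A : 'M[R]_(m, n)) :
  continuous (fun w : 'rV[R]_m => w *m A).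
Proof.
move=> x; apply: continuous_row => j.
rewrite (_ : (fun _ => _) = fun t : 'rV[R]_m => \sum_i t 0 i * A i j); last first.
  by apply/funext => t; rewrite mxE.
apply: continuous_sum => i.
by apply: continuousM; [exact: coord_continuous | exact: cst_continuous].
Qed.

Lemma is_derive_row (R : realType) n (f : R -> 'rV[R]_n) (t : R) (d : 'rV[R]_n) :
  is_derive t 1 f d <-> forall j, is_derive t 1 (fun s => f s 0 j) (d 0 j).
Proof.
split=> [[df <-] j | df].
  by split; [move/derivable_mxP: df; apply | rewrite derive_mx// mxE].
have dvf : derivable f t 1.
  by apply/derivable_mxP => i j; rewrite ord1; apply: ex_derive.
split=> //; rewrite derive_mx//; apply/rowP => j; rewrite mxE.
exact: derive_val.
Qed.

(** The Jacobian is diagonal because every coordinate hyperplane is invariant: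
    the remainder at the origin is [w_j * (r w - r 0)_j], which is [o(w)] by
    continuity of [r]. *)
Lemma jacobian_invariant_axes (R : realType) n (g : 'rV[R]_n -> 'rV[R]_n)
    (r : 'rV[R]_n -> 'rV[R]_n) :
  (forall w j, g w 0 j = w 0 j * r w 0 j) -> {for 0, continuous r} ->
  'J g 0 = diag_mx (r 0).
Proof.
move=> gE cr; pose D := diag_mx (r 0).
have dE : 'd g 0 = mulmxr D :> (_ -> _).
  apply: diff_unique; first exact: continuous_mulmxr.
  apply/eqaddoP => e e0; near=> w.
  rewrite /= [X in `|X|](_ : _ = \row_j (w 0 j * (r w - r 0) 0 j)); last first.
    apply/rowP => j; rewrite /cst !fctE/= addr0 /D mul_mx_diag !mxE !gE mxE mul0r.
    by ring.
  rewrite [leLHS]/Num.Def.normr/= mx_normrE; apply: bigmax_le => [|[i j] _].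
    by rewrite mulr_ge0// ltW.
  rewrite !mxE/= normrM mulrC ler_pM//.
    have : `|r w - r 0| <= e.
      by rewrite distrC; near: w; move/cvgrPdist_le: cr; apply.
    apply: le_trans; rewrite [leRHS]/Num.Def.normr/= mx_normrE.
    by apply: le_trans (le_bigmax _ _ (0, j)); rewrite !mxE.
  by rewrite [leRHS]/Num.Def.normr/= mx_normrE; apply: (le_bigmax _ _ (0, j)).
apply/row_matrixP => i; rewrite rowE -[LHS]/(delta_mx 0 i *m lin1_mx ('d g 0)).
by rewrite mul_rV_lin1 dE rowE.
Unshelve. all: by end_near. Qed.

Lemma diff_affine (R : realType) m n (f : 'rV[R]_m -> 'rV[R]_n)
    (A : 'M[R]_(m, n)) p :
  (forall u, f u = f 0 + u *m A) -> 'd f p = mulmxr A :> (_ -> _).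
Proof.
move=> fE; apply: diff_unique; first exact: continuous_mulmxr.
apply/eqaddoP => e e0; apply: nearW => w.
rewrite /= /cst !fctE /= (fE (w + p)) (fE p) mulmxDl.
rewrite [w *m A + _]addrC addrA subrr normr0.
by apply: mulr_ge0; rewrite ?normr_ge0 ?ltW.
Qed.

(** * The scalar equation with simple poles at both ends of the orbit *)

Section SingularEquation.
Variable R : realType.
Implicit Types (p q t h : R) (u : R -> R).

(** The positive solution of [u' = (p / t + q / (1 - t)) u] on the unit interval.
    The reciprocal of [singular_sol p q] is [singular_sol (- p) (- q)]. *)
Definition singular_sol p q t : R := t `^ p * (1 - t) `^ (- q).

Lemma is_derive_singular_sol p q t : 0 < t < 1 ->
  is_derive t 1 (singular_sol p q) ((p / t + q / (1 - t)) * singular_sol p q t).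
Proof.
move=> /andP[t0 t1]; have s0 : 0 < 1 - t by rewrite subr_gt0.
have d1 := is_derive1_powR p t0.
have d2 := is_deriveB (is_derive_cst (1 : R) t 1) (is_derive_id t 1).
have d3 := @is_derive1_comp R (fun x : R => x `^ (- q)) (cst 1 - id) t _ _
  (is_derive1_powR (- q) s0) d2.
have d4 := is_deriveM d1 d3.
have E : (fun x : R => x `^ p) * ((fun x : R => x `^ (- q)) \o (cst 1 - id)) =
    singular_sol p q.
  by apply/funext.
rewrite E in d4; apply: (is_derive_eq d4).
rewrite /singular_sol !powRB ?(gt_eqF t0) ?(gt_eqF s0) ?implybT// !powRr1 ?ltW//.
by rewrite /GRing.scale/=; field; rewrite !gt_eqF.
Qed.

(** Dividing a solution by the positive one gives a constant, which proves
    uniqueness. Both poles contribute the same base because the reflection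
    [t -> 1 - t] exchanges the ends [h] and [1 - h]. *)
Lemma singular_ode_ratio p q u h : 0 < h <= 1 / 2 ->
  (forall t, 0 < t < 1 -> is_derive t 1 u ((p / t + q / (1 - t)) * u t)) ->
  u (1 - h) = ((1 - h) / h) `^ (p + q) * u h.
Proof.
move=> /andP[h0 h12] du; have h1 : h < 1 by lra.
have k0 : 0 < 1 - h by lra.
pose v := singular_sol (- p) (- q) * u.
have dv t : 0 < t < 1 -> is_derive t 1 v 0.
  move=> t01.
  have d := is_deriveM (is_derive_singular_sol (- p) (- q) t01) (du t t01).
  by apply: (is_derive_eq d); rewrite /GRing.scale/=; ring.
have vE : v (1 - h) = v h.
  apply/eqP; rewrite -subr_eq0; apply/eqP.
  have in01 t : t \in `[h, 1 - h] -> 0 < t < 1.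
    by rewrite in_itv/= => /andP[ht th]; apply/andP; split; lra.
  have [|t ht||c _ ->] := @MVT_segment R v (cst 0) h (1 - h).
  - by lra.
  - by apply/dv/in01/subset_itv_oo_cc.
  - apply: derivable_within_continuous => t /in01 /dv dt.
    exact: ex_derive.
  - by rewrite mul0r.
have a0 := powR_gt0 p h0; have b0 := powR_gt0 q h0.
have c0 := powR_gt0 p k0; have d0 := powR_gt0 q k0.
move: vE; rewrite /v /singular_sol !fctE /= opprK subKr !powRN => vE.
rewrite powRD ?(gt_eqF (divr_gt0 k0 h0)) ?implybT// !powRM ?invr_ge0 ?ltW//.
rewrite -(powR_inv1 (ltW h0)) -!powRrM !mulN1r !powRN.
have -> : u (1 - h) =
    ((1 - h) `^ p)^-1 * h `^ q * u (1 - h) * ((1 - h) `^ p / h `^ q).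
  by field; rewrite !gt_eqF.
by rewrite vE; field; rewrite !gt_eqF.
Qed.

End SingularEquation.

(** * The field in local coordinates *)

Section Rates.
Variable R : realType.
Implicit Types (eX eY h t : R) (p z : 'rV[R]_4) (v : source).

Definition growth (M : 'M[R]_3) (u v : 'cV[R]_3) (i : 'I_3) : R :=
  (M *m v) i 0 - (u^T *m M *m v) 0 0.

(** The factor of [z_i] in the i-th component of the field. A coordinate of [v]
    that is not itself an entry of the ambient coordinates is, up to sign, the
    third barycentric coordinate, which explains the index 2. *)
Definition rate eX eY v z : 'rV[R]_4 :=
  let p := unchart v z in
  let x := mixed (p 0 (inord 0)) (p 0 (inord 1)) in
  let y := mixed (p 0 (inord 2)) (p 0 (inord 3)) in
  let gX i := growth (payoff eX) x y (inord i) in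
  let gY i := growth (payoff eY) y x (inord i) in
  match v with
  | PP => row4 (gX 0%N) (gX 1%N) (gY 0%N) (gY 1%N)
  | PS => row4 (gX 0%N) (gX 1%N) (gY 0%N) (gY 2%N)
  | SP => row4 (gX 0%N) (gX 2%N) (gY 0%N) (gY 1%N)
  end.

Lemma growthE (M : 'M[R]_3) (u v : 'cV[R]_3) i : growth M u v i =
  \sum_j M i j * v j 0 - \sum_j (\sum_k u k 0 * M k j) * v j 0.
Proof.
rewrite /growth !mxE; congr (_ - _); apply: eq_bigr => j _.
by rewrite !mxE; under eq_bigr do rewrite !mxE.
Qed.

(** The linear part of the affine map [chart v], acting on rows. *)
Definition chart_mx v : 'M[R]_4 :=
  match v with
  | PP => 1%:M
  | PS => 1%:M + delta_mx (inord 2) (inord 3)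
  | SP => 1%:M + delta_mx (inord 0) (inord 1)
  end.

Lemma mul_row_delta n m (u : 'rV[R]_n) (i : 'I_n) (j k : 'I_m) :
  (u *m delta_mx i j) 0 k = u 0 i *+ (k == j).
Proof.
rewrite mxE (bigD1 i)//= big1 ?addr0 => [|l li]; rewrite mxE ?eqxx/=.
  by rewrite mulr_natr.
by rewrite (negPf li) mulr0.
Qed.

Lemma inord_eq n i j : (i <= n)%N -> (j <= n)%N ->
  ((inord i : 'I_n.+1) == inord j) = (i == j).
Proof. by move=> ? ?; rewrite -val_eqE /= !inordK. Qed.

Lemma row4E (a b c d : R) :
  (row4 a b c d 0 (inord 0) = a) * (row4 a b c d 0 (inord 1) = b) *
  (row4 a b c d 0 (inord 2) = c) * (row4 a b c d 0 (inord 3) = d).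
Proof. by rewrite !mxE !inordK. Qed.

Lemma diff_chart v p : 'd (chart v) p = mulmxr (chart_mx v) :> (_ -> _).
Proof.
apply: diff_affine => u; case: v; rewrite /chart /chart_mx ?mulmxDr mulmx1;
  by apply: row4P; rewrite !(row4E, mul_row_delta, inord_eq, mxE) ?inordK//=; ring.
Qed.

Lemma mixedE (a b : R) :
  (mixed a b (inord 0) 0 = a) * (mixed a b (inord 1) 0 = b) *
  (mixed a b (inord 2) 0 = 1 - a - b).
Proof. by rewrite !mxE !inordK. Qed.

Lemma sum3 (F : 'I_3 -> R) :
  \sum_i F i = F (inord 0) + F (inord 1) + F (inord 2).
Proof.
rewrite !big_ord_recl big_ord0 addr0 addrA.
by congr (F _ + F _ + F _); apply: val_inj; rewrite /= inordK.
Qed.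

(** The replicator field is tangent to the simplex, so the third component is
    minus the sum of the other two. *)
Lemma replicator_sum (M : 'M[R]_3) (a b : R) (v : 'cV[R]_3) :
  replicator M (mixed a b) v (inord 0) + replicator M (mixed a b) v (inord 1) =
  - ((1 - a - b) * growth M (mixed a b) v (inord 2)).
Proof.
by rewrite /replicator -!/(growth _ _ _ _) !growthE !sum3 !mixedE; ring.
Qed.

Lemma mul_chart_mx v (a b c d : R) :
  row4 a b c d *m chart_mx v =
  match v with
  | PP => row4 a b c d | PS => row4 a b c (c + d) | SP => row4 a (a + b) c d
  end.
Proof.
case: v; rewrite /chart_mx ?mulmxDr mulmx1 //; apply: row4P;
  by rewrite mxE mul_row_delta !row4E inord_eq//= ?addr0 // addrC.
Qed.

Lemma replicatorE (M : 'M[R]_3) (u v : 'cV[R]_3) i :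
  replicator M u v i = u i 0 * growth M u v i.
Proof. by []. Qed.

Lemma local_fieldE eX eY v z :
  local_field eX eY v z = field eX eY (unchart v z) *m chart_mx v.
Proof. by rewrite /local_field diff_chart. Qed.

(** In the chart at (P, S) the fourth coordinate is minus the third barycentric
    coordinate of the second player, and at (S, P) the second coordinate is minus
    that of the first player; the sign cancels in the factorization. *)
Lemma local_field_rate eX eY v z :
  local_field eX eY v z = \row_i (z 0 i * rate eX eY v z 0 i).
Proof.
rewrite local_fieldE /field mul_chart_mx /rate.
case: v; rewrite /unchart !row4E; apply: row4P; rewrite !row4E [RHS]mxE !row4E;
  rewrite ?replicator_sum ?replicatorE ?mixedE.
all: by rewrite -?mulNr; congr (_ * _); ring.
Qed.

Lemma zeta_rate eX eY v k t :
  zeta eX eY v k t 0 = t * rate eX eY v (insert k t 0) 0 k.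
Proof. by rewrite /zeta local_field_rate 2!mxE unlift_none. Qed.

Lemma continuous_growth (T : topologicalType) (M : 'M[R]_3)
    (u v : T -> 'cV[R]_3) i x :
  (forall j, {for x, continuous (fun s => u s j 0)}) ->
  (forall j, {for x, continuous (fun s => v s j 0)}) ->
  {for x, continuous (fun s => growth M (u s) (v s) i)}.
Proof.
move=> cu cv.
rewrite (_ : (fun _ => _) = fun s => \sum_j M i j * v s j 0 -
   \sum_j (\sum_k u s k 0 * M k j) * v s j 0); last first.
  by apply/funext => s; rewrite growthE.
have cM j k : {for x, continuous (fun _ : T => M j k)} by exact: cst_continuous.
apply: continuousB; apply: continuous_sum => j; apply: continuousM => //.
by apply: continuous_sum => k; apply: continuousM.
Qed.

Lemma continuous_mixed (T : topologicalType) (a b : T -> R) j x :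
  {for x, continuous a} -> {for x, continuous b} ->
  {for x, continuous (fun s => mixed (a s) (b s) j 0)}.
Proof.
move=> ca cb.
have c1 : {for x, continuous (fun _ : T => 1 : R)} by exact: cst_continuous.
have -> : (fun s => mixed (a s) (b s) j 0) =
  (fun s => [:: a s; b s; 1 - a s - b s]`_j) by apply/funext => s; rewrite mxE.
case: j => -[|[|[|//]]] ? //=.
by apply: continuousB => //; apply: continuousB.
Qed.

Lemma continuous_insert (k : 'I_4) t j w :
  {for w, continuous (fun w => insert k t w 0 j)}.
Proof.
have -> : (fun w => insert k t w 0 j) =
    (fun w => if unlift k j is Some i then w 0 i else t).
  by apply/funext => s; rewrite mxE.
case: (unlift k j) => [i|]; [exact: coord_continuous|exact: cst_continuous].
Qed.

Lemma continuous_rate (T : topologicalType) eX eY v (f : T -> 'rV[R]_4) x :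
  (forall j, {for x, continuous (fun s => f s 0 j)}) ->
  {for x, continuous (fun s => rate eX eY v (f s))}.
Proof.
move=> cf.
have c1 : {for x, continuous (fun _ : T => 1 : R)} by exact: cst_continuous.
have row4c (a b c d : T -> R) i :
    {for x, continuous a} -> {for x, continuous b} ->
    {for x, continuous c} -> {for x, continuous d} ->
    {for x, continuous (fun s => row4 (a s) (b s) (c s) (d s) 0 i)}.
  rewrite (_ : (fun s => row4 _ _ _ _ _ _) =
               (fun s => [:: a s; b s; c s; d s]`_i)); last first.
    by apply/funext => s; rewrite mxE.
  by case: i => -[|[|[|[|//]]]].
have cu j : {for x, continuous (fun s => unchart v (f s) 0 j)}.
  by case: v; apply: row4c => //; apply: continuousD => //; apply: continuousB.
apply: continuous_row => j; case: v cu => cu; apply: row4c;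
  by apply: continuous_growth => i; apply: continuous_mixed.
Qed.

Lemma insert0 k t : insert k t 0 = t *: delta_mx 0 k :> 'rV[R]_4.
Proof.
apply/rowP => j; rewrite !mxE; case: unliftP => [i ->|->]; rewrite ?mxE.
  by rewrite eq_sym (negPf (neq_lift k i)) mulr0.
by rewrite !eqxx mulr1.
Qed.

Lemma scale_deltaE t (k j : 'I_4) :
  (t *: delta_mx 0 k : 'rV[R]_4) 0 j = t * (j == k)%:R.
Proof. by rewrite !mxE eqxx. Qed.

(** The growth rate is affine in each player's mixed strategy separately, and a
    coordinate axis moves only one of the two. *)
Lemma rate_edge eX eY v (k : 'I_4) t :
  rate eX eY v (t *: delta_mx 0 k) =
  (1 - t) *: rate eX eY v 0 + t *: rate eX eY v (delta_mx 0 k).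
Proof.
have d0 : (0 : 'rV[R]_4) = 0 *: delta_mx 0 k by rewrite scale0r.
have d1 : delta_mx 0 k = 1 *: delta_mx 0 k :> 'rV[R]_4 by rewrite scale1r.
rewrite [in RHS]d1 d0 /rate.
apply: row4P; case: v;
  rewrite [RHS]mxE [X in _ = X + _]mxE [X in _ = _ + X]mxE;
  rewrite /unchart !row4E !scale_deltaE !growthE !sum3 !mixedE;
  by case: k {d0 d1} => -[|[|[|[|//]]]] ?; rewrite -!val_eqE /= !inordK//=; ring.
Qed.

Lemma field_vertex eX eY w : field eX eY (vertex R w) = 0.
Proof.
case: w => [[] []]; apply: row4P;
  rewrite /field /vertex /= !row4E mxE /replicator -!/(growth _ _ _ _);
  by rewrite !growthE !sum3 !mixedE; ring.
Qed.

(** The target is an equilibrium whose k-th coordinate is 1, so the factorization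
    of the field leaves no other value for the k-th rate. *)
Lemma rate_end eX eY v w (k : 'I_4) :
  chart v (vertex R w) = delta_mx 0 k -> rate eX eY v (delta_mx 0 k) 0 k = 0.
Proof.
move=> wk; have /rowP /(_ k) := local_field_rate eX eY v (delta_mx 0 k).
rewrite local_fieldE -{1}wk chartK field_vertex mul0mx !mxE !eqxx mul1r.
by move=> <-.
Qed.

End Rates.

(** * The linearized equation and the global map *)

Section GlobalMap.
Variable R : realType.
Implicit Types (eX eY h t : R) (v : source).

Lemma jacobian_transverse eX eY v k t :
  'J (transverse eX eY v k t) 0 =
  diag_mx (col' k (rate eX eY v (t *: delta_mx 0 k))).
Proof.
pose r w := rate eX eY v (insert k t w).
rewrite -insert0; apply: (@jacobian_invariant_axes _ _ _ (fun w => col' k (r w))).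
  by move=> w j; rewrite /transverse local_field_rate !mxE liftK.
apply: continuous_row => j.
have cr : {for 0, continuous r}.
  by apply: continuous_rate => i; exact: continuous_insert.
rewrite (_ : (fun _ => _) = (fun M : 'rV[R]_4 => M 0 (lift k j)) \o r).
  by apply: continuous_comp; [exact: cr | exact: coord_continuous].
by apply/funext => w; rewrite /= mxE.
Qed.

Section Orbit.
Variables (eX eY : R) (v : source) (w : strategy * strategy) (k : 'I_4).
Hypothesis target : chart v (vertex R w) = delta_mx 0 k.
Variables a b : 'rV[R]_4.
Hypothesis rate_a : rate eX eY v 0 = a.
Hypothesis rate_b : rate eX eY v (delta_mx 0 k) = b.
Hypothesis a_k : a 0 k != 0.

Let p j := a 0 (lift k j) / a 0 k.
Let q j := b 0 (lift k j) / a 0 k.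

(** As [b_k = 0], the speed along the orbit is [a_k t (1 - t)], and partial
    fractions turn [((1 - t) a_i + t b_i) / (a_k t (1 - t))] into
    [p / t + q / (1 - t)]. *)
Lemma linearized_solutionP (zt : R -> 'rV[R]_3) :
  linearized_solution eX eY v k zt <->
  forall j t, 0 < t < 1 ->
    is_derive t 1 (fun s => zt s 0 j) ((p j / t + q j / (1 - t)) * zt t 0 j).
Proof.
have b_k : b 0 k = 0 by rewrite -rate_b; exact: rate_end target.
have E t j : 0 < t < 1 ->
   ((zeta eX eY v k t 0)^-1 *: (zt t *m 'J (transverse eX eY v k t) 0)) 0 j =
   (p j / t + q j / (1 - t)) * zt t 0 j.
  move=> /andP[t0 t1]; rewrite jacobian_transverse zeta_rate insert0 rate_edge.
  rewrite rate_a rate_b mul_mx_diag /p /q !mxE b_k mulr0 addr0; field.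
  by rewrite a_k !gt_eqF ?subr_gt0.
split=> [H j t t01|H t t01].
  by rewrite -E//; move/is_derive_row: (H t t01); apply.
by apply/is_derive_row => j; rewrite E//; exact: H.
Qed.

(** The coefficient of each scalar equation forces the ratio between the two
    sections, and multiples of [singular_sol] realize it for every initial
    condition. *)
Lemma global_mapP h (z z' : 'rV[R]_4) : 0 < h <= 1 / 2 -> z 0 k = h ->
  global_map eX eY h v w z z' <->
  z' = \row_i (if i == k then 1 - h
     else ((1 - h) / h) `^ ((a 0 i + b 0 i) / a 0 k) * z 0 i).
Proof.
move=> hh zk.
split=> [[k' [target' _ z'k [zt [sol zth zth']]]]|->].
  have kk : k' = k.
    move: target'; rewrite target => /rowP /(_ k'); rewrite !mxE !eqxx/=.
    by case: eqP => // _ /eqP; rewrite eq_sym oner_eq0.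
  rewrite {k' target'}kk in z'k sol zth zth'.
  move/linearized_solutionP: sol => sol.
  apply/rowP => i; rewrite mxE; case: (unliftP k i) => [j ->|->]; last first.
    by rewrite eqxx.
  rewrite eq_sym (negPf (neq_lift k j)).
  have := singular_ode_ratio hh (sol j).
  by rewrite zth zth' !mxE (mulrDl (a 0 _)).
exists k; split => //; first by rewrite mxE eqxx.
have f0 j : singular_sol (p j) (q j) h != 0.
  have /andP[h0 h1] : 0 < h < 1.
    by move/andP: hh => [? ?]; apply/andP; split; lra.
  by rewrite /singular_sol mulf_neq0// gt_eqF// powR_gt0// subr_gt0.
pose c j := z 0 (lift k j) / singular_sol (p j) (q j) h.
exists (fun t => \row_j (c j * singular_sol (p j) (q j) t)); split.
- apply/linearized_solutionP => j t t01; rewrite mxE.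
  rewrite (_ : (fun _ => _) = c j *: singular_sol (p j) (q j)); last first.
    by apply/funext => s; rewrite mxE.
  apply: (is_derive_eq (is_deriveZ _ (is_derive_singular_sol (p j) (q j) t01))).
  by rewrite /GRing.scale/= mulrCA.
- by apply/rowP => j; rewrite !mxE /c divfK.
- apply/rowP => j; rewrite !mxE eq_sym (negPf (neq_lift k j)).
  rewrite (mulrDl (a 0 _)) -/(p j) -/(q j).
  have /= -> := singular_ode_ratio hh (@is_derive_singular_sol R (p j) (q j)).
  by rewrite mulrCA /c divfK.
Qed.

End Orbit.
End GlobalMap.

(** * Eigenvalues at the ends of the orbits *)

(** The matrix is circulant. *)
Lemma payoffE (R : realType) (e : R) i j : (i <= 2)%N -> (j <= 2)%N ->
  payoff e (inord i) (inord j) =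
   2 / 3 * e *+ (i == j) + (1 - 1 / 3 * e) *+ (j == i.+1 %% 3)%N
   + (- 1 - 1 / 3 * e) *+ (i == j.+1 %% 3)%N.
Proof.
move=> hi hj; rewrite mxE !inordK//.
by move: i j hi hj => [|[|[|//]]] [|[|[|//]]] _ _ /=; rewrite ?addr0 ?add0r.
Qed.

Lemma rate_base (R : realType) (eX eY : R) v : rate eX eY v 0 =
  match v with
  | PP => row4 (- 1 - eX) (1 - eX) (- 1 - eY) (1 - eY)
  | PS => row4 2 (1 + eX) (- 2) (- 1 + eY)
  | SP => row4 (- 2) (- 1 + eX) 2 (1 + eY)
  end.
Proof.
case: v; rewrite /rate /unchart !row4E !mxE; apply: row4P;
  by rewrite !row4E !growthE !sum3 !mixedE !payoffE //=; lra.
Qed.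

Lemma rate_target (R : realType) (eX eY : R) :
  [/\ rate eX eY PP (delta_mx 0 (inord 3)) = row4 2 (1 + eX) (- 2) 0,
      rate eX eY PP (delta_mx 0 (inord 1)) = row4 (- 2) 0 2 (1 + eY),
      rate eX eY PS (delta_mx 0 (inord 0)) = row4 0 (- 1 + eX) (1 + eY) 2 &
      rate eX eY PS (delta_mx 0 (inord 1)) = row4 (1 - eX) 0 (1 - eY) (- 1 - eY)] /\
  rate eX eY SP (delta_mx 0 (inord 3)) = row4 (1 - eX) (- 1 - eX) (1 - eY) 0 /\
  rate eX eY SP (delta_mx 0 (inord 2)) = row4 (1 + eX) 2 0 (- 1 + eY).
Proof.
split; [split | split]; rewrite /rate /unchart !row4E !mxE !eqxx;
  rewrite !inord_eq//=; apply: row4P;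
  by rewrite !row4E !growthE !sum3 !mixedE !payoffE //=; lra.
Qed.

Lemma iff_eq_r (T : Type) (x y z : T) : y = z -> x = y <-> x = z.
Proof. by move=> ->. Qed.

(** Reads one formula off the eigenvalues [ra] at the source and [rb] at the
    target: what remains after [global_mapP] is to identify the target with a
    basis vector, to see that the eigenvalue along the orbit is nonzero, and to
    compare the exponents, whose denominators are nonzero by the hypotheses on
    eX and eY. *)
Ltac global_map_from_eigenvalues ra rb hh :=
  apply: (iff_trans (global_mapP _ ra rb _ _ hh _)); last apply: iff_eq_r;
  [ by apply: row4P; rewrite /= !row4E !mxE !inord_eq//= ?eqxx; ring
  | by rewrite row4E; lra
  | by rewrite row4E
  | by apply: row4P; rewrite [LHS]mxE !row4E !inord_eq//=;
       congr (_ `^ _ * _); field; lra ].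

Theorem proposition9 (R : realType) (eX eY h : R)
    (heX : -1 < eX < 1) (heY : -1 < eY < 1) (hh : 0 < h < 1 / 2) :
  let kappa : R := (1 - h) / h in
  (forall (z1 z2 z3 : R) (z' : 'rV[R]_4),
      global_map eX eY h PP (Paper, Scissors) (row4 z1 z2 z3 h) z' <->
      z' = row4 (kappa `^ ((1 - eX) / (1 - eY)) * z1)
                (kappa `^ (2 / (1 - eY)) * z2)
                (kappa `^ (- ((3 + eY) / (1 - eY))) * z3)
                (1 - h)) /\
  (forall (z1 z3 z4 : R) (z' : 'rV[R]_4),
      global_map eX eY h PP (Scissors, Paper) (row4 z1 h z3 z4) z' <->
      z' = row4 (kappa `^ (- ((3 + eX) / (1 - eX))) * z1)
                (1 - h)
                (kappa `^ ((1 - eY) / (1 - eX)) * z3)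
                (kappa `^ (2 / (1 - eX)) * z4)) /\
  (forall (z2 z3 z4 : R) (z' : 'rV[R]_4),
      global_map eX eY h PS (Rock, Scissors) (row4 h z2 z3 z4) z' <->
      z' = row4 (1 - h)
                (kappa `^ eX * z2)
                (kappa `^ (- ((1 - eY) / 2)) * z3)
                (kappa `^ ((1 + eY) / 2) * z4)) /\
  (forall (z1 z3 z4 : R) (z' : 'rV[R]_4),
      global_map eX eY h PS (Scissors, Scissors) (row4 z1 h z3 z4) z' <->
      z' = row4 (kappa `^ (- ((- 3 + eX) / (1 + eX))) * z1)
                (1 - h)
                (kappa `^ (- ((1 + eY) / (1 + eX))) * z3)
                (kappa `^ (- (2 / (1 + eX))) * z4)) /\
  (forall (z1 z2 z3 : R) (z' : 'rV[R]_4),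
      global_map eX eY h SP (Scissors, Scissors) (row4 z1 z2 z3 h) z' <->
      z' = row4 (kappa `^ (- ((1 + eX) / (1 + eY))) * z1)
                (kappa `^ (- (2 / (1 + eY))) * z2)
                (kappa `^ (- 1 + 4 / (1 + eY)) * z3)
                (1 - h)) /\
  (forall (z1 z2 z4 : R) (z' : 'rV[R]_4),
      global_map eX eY h SP (Scissors, Rock) (row4 z1 z2 h z4) z' <->
      z' = row4 (kappa `^ (- ((1 - eX) / 2)) * z1)
                (kappa `^ ((1 + eX) / 2) * z2)
                (1 - h)
                (kappa `^ eY * z4)).
Proof.
move: hh heX heY => /andP[h0 h1] /andP[X0 X1] /andP[Y0 Y1] kappa.
have hh2 : 0 < h <= 1 / 2 by rewrite h0 ltW.
have [[PP3 PP1 PS0 PS1] [SP3 SP2]] := rate_target eX eY.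
have PPsrc := rate_base eX eY PP; have PSsrc := rate_base eX eY PS.
have SPsrc := rate_base eX eY SP.
split; last split; last split; last split; last split; move=> ? ? ? z'.
- global_map_from_eigenvalues PPsrc PP3 hh2.
- global_map_from_eigenvalues PPsrc PP1 hh2.
- global_map_from_eigenvalues PSsrc PS0 hh2.
- global_map_from_eigenvalues PSsrc PS1 hh2.
- global_map_from_eigenvalues SPsrc SP3 hh2.
- global_map_from_eigenvalues SPsrc SP2 hh2.
Qed.
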